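(* Let $\alpha\in\mathbb{R}$, let $\mathcal{A}$ be a real antisymmetric $n\times n$ matrix and $\mathbf{v}\in\mathbb{R}^n$ with $\mathcal{A}\mathbf{v}=0$ (and $\mathbf{v}=0$ if $\alpha\neq0$). There is a constant $C<\infty$ depending only on $\alpha$ and $\mathcal{A}$ such that for any point $\mathbf{C}_0=\mathbf{C}(s_0)$, with unit tangent $\mathbf{T}_0=\mathbf{C}_s(s_0)$, on a soliton $\mathbf{C}$ with parameters $(\alpha,\mathcal{A},\mathbf{v})$ that satisfies \[ A_0=\|\mathbf{a}(\mathbf{C}_0)\|\geq C\quad\text{and}\quad|\mu(\mathbf{C}_0,\mathbf{T}_0)|\leq1-CA_0^{-4}, \] there exist $s_-<s_+$ with $s_0\in[s_-,s_+]$ and \[ s_+-s_-\leq\frac{C}{A_0}\ln A_0, \] such that at the ends of the arc $\mathbf{C}([s_-,s_+])$ one has \[ \mu(s_-)=-\bigl(1-CA_0^{-4}\bigr)\quad\text{and}\quad\mu(s_+)=1-CA_0^{-4}. \]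
   Context: A soliton with parameters $(\alpha,\mathcal{A},\mathbf{v})$ is a smooth curve $\mathbf{C}:\mathbb{R}\to\mathbb{R}^n$, parametrized by arc length $s$, satisfying $\mathbf{C}_{ss}=(\alpha+\mathcal{A})\mathbf{C}+\mathbf{v}+\lambda\mathbf{C}_s$, where $\alpha$ stands for $\alpha$ times the identity and $\lambda(s)=-\langle(\alpha+\mathcal{A})\mathbf{C}+\mathbf{v},\mathbf{C}_s\rangle$ is determined by $\mathbf{C}_s\perp\mathbf{C}_{ss}$. With $\mathbf{T}=\mathbf{C}_s$, put $\mathbf{a}(\mathbf{C})=(\alpha+\mathcal{A})\mathbf{C}+\mathbf{v}$, $\hat{\mathbf{a}}=\mathbf{a}/\|\mathbf{a}\|$ and $\mu(\mathbf{C},\mathbf{T})=\langle\hat{\mathbf{a}}(\mathbf{C}),\mathbf{T}\rangle$; $\mu(s)$ denotes $\mu(\mathbf{C}(s),\mathbf{T}(s))$. *)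

(* Defs.v *)
From mathcomp Require Import all_boot all_order all_algebra.
From mathcomp Require Import all_classical all_reals all_analysis.

Set Implicit Arguments.
Unset Strict Implicit.
Unset Printing Implicit Defensive.

Import Order.TTheory GRing.Theory Num.Theory.
Import numFieldNormedType.Exports.

Local Open Scope ring_scope.

(* The library norm [`|x|] on matrices is the sup norm, so the Euclidean
   structure is introduced here. *)
Definition dotv (R : realType) (n : nat) (x y : 'cV[R]_n) : R :=
  \sum_(i < n) x i 0 * y i 0.

Definition enorm (R : realType) (n : nat) (x : 'cV[R]_n) : R :=
  Num.sqrt (dotv x x).

Definition smooth_curve (R : realType) (n : nat) (c : R -> 'cV[R]_n) : Prop :=
  forall (k : nat) (s : R), derivable (derive1n k c) s 1.

Definition avec (R : realType) (n : nat) (alpha : R) (A : 'M[R]_n)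
    (v x : 'cV[R]_n) : 'cV[R]_n :=
  (alpha%:M + A) *m x + v.

Definition ahat (R : realType) (n : nat) (alpha : R) (A : 'M[R]_n)
    (v x : 'cV[R]_n) : 'cV[R]_n :=
  (enorm (avec alpha A v x))^-1 *: avec alpha A v x.

(* Where [avec alpha A v x = 0] the quotient is undefined on paper; here
   [0^-1 = 0] makes [mu] vanish. *)
Definition mu (R : realType) (n : nat) (alpha : R) (A : 'M[R]_n)
    (v x t : 'cV[R]_n) : R :=
  dotv (ahat alpha A v x) t.

Definition soliton (R : realType) (n : nat) (alpha : R) (A : 'M[R]_n)
    (v : 'cV[R]_n) (c : R -> 'cV[R]_n) : Prop :=
  [/\ smooth_curve c,
      forall s : R, enorm (derive1 c s) = 1 &
      forall s : R,
        let lambda := - dotv (avec alpha A v (c s)) (derive1 c s) in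
        derive1n 2 c s = avec alpha A v (c s) + lambda *: derive1 c s].

(* Main.v *)
Require Import Defs.
From mathcomp Require Import all_boot all_order all_algebra.
From mathcomp Require Import all_classical all_reals all_analysis.
From mathcomp Require Import ring lra.
Import Order.TTheory GRing.Theory Num.Theory.
Import numFieldNormedType.Exports.
Local Open Scope classical_set_scope.
Local Open Scope ring_scope.

(** Write a(s) for the vector (alpha + A) C(s) + v, p for its length, T for the
    unit tangent and q = <a, T> = p mu. Since A is antisymmetric,
      q' = alpha + p^2 - q^2   and   p p' = alpha q + <a, A T>,
    so that
      mu' = (p + alpha / p) (1 - mu^2) - mu <a, A T> / p^2.
    Again by antisymmetry only the component of T orthogonal to a contributes
    to <a, A T>, whence |<a, A T>| <= K p sqrt (1 - mu^2), where K bounds the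
    norm of A. As long as p >= A0 / 2 and 1 - |mu| >= C A0^-4 with C large, the
    first term dominates and mu satisfies the logistic inequality
      mu' >= (A0 / 4) (1 - mu^2)                     ([soliton_mu_slope_ge]).
    The vector a moves with speed at most M = |alpha| + K, hence p >= A0 / 2 on
    the whole interval |s - s0| <= L with L = 16 ln A0 / A0, because
    M L <= A0 / 2 when A0 is large              ([soliton_enorm_avec_ge]).

    Put b = 1 - C A0^-4. Under the logistic inequality mu cannot go below -b
    after s0, and ln ((1 + mu) / (1 - mu)) grows at least at the rate A0 / 2;
    between the levels -b and b it varies by
    2 ln ((1 + b) / (1 - b)) <= 8 ln A0, so mu reaches b before s0 + L
    ([logistic_reaches]). Reversing s and the sign of mu gives the point where
    mu = -b after s0 - L ([logistic_reaches_left]). *)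

(** * Scalar differential inequalities *)

Lemma is_derive_continuous {R : realType} {f : R -> R} {x d : R} :
  is_derive x 1 f d -> {for x, continuous f}.
Proof.
by move=> fx; apply/differentiable_continuous/derivable1_diffP; case: fx.
Qed.

Lemma is_derive_within_continuous {R : realType} {f df : R -> R} {a b : R} :
  (forall s, a <= s <= b -> is_derive s 1 f (df s)) ->
  {within `[a, b]%classic, continuous f}.
Proof.
move=> fdf; apply: derivable_within_continuous => s.
by rewrite in_itv/= => /fdf [].
Qed.

Lemma derive_gt0_right {R : realType} {f : R -> R} {x d : R} :
  is_derive x 1 f d -> 0 < d -> \forall y \near x^'+, f x < f y.
Proof.
move=> [fx fd] d0.
have : h^-1 *: (f (h *: 1 + x) - f x) @[h --> 0^'] --> d.
  by rewrite -fd; exact: fx.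
move=> /cvgrPdist_lt /(_ d d0)[/= e e0 he].
exists e => //= y; rewrite /ball_/= => xye xy.
have yx0 : 0 < y - x by rewrite subr_gt0.
have := he (y - x); rewrite /ball_/= sub0r normrN.
have -> : `|y - x| < e by rewrite distrC.
rewrite gt_eqF// => /(_ isT isT).
rewrite /GRing.scale/= mulr1 subrK.
by move=> /ltr_normlW; rewrite gtrBl pmulr_rgt0 ?invr_gt0// subr_gt0.
Qed.

(** A level that the function can only cross upwards is never left downwards. *)
Lemma ge_of_upward_crossing {R : realType} {f df : R -> R} {a t b : R} :
  a <= t -> (forall s, a <= s <= t -> is_derive s 1 f (df s)) ->
  (forall s, a <= s <= t -> f s = b -> 0 < df s) ->
  b <= f a -> b <= f t.
Proof.
move=> at' fdf df0 ba; rewrite leNgt; apply/negP => ftb.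
set E := [set s | a <= s <= t /\ b <= f s]%classic.
have Ea : E a by split=> //; rewrite lexx at'.
have supE : has_sup E by split; [exists a|exists t => s [/andP[]]].
set m := sup E.
have am : a <= m by exact: (ub_le_sup (proj2 supE)).
have mt : m <= t by apply: ge_sup; [exists a|move=> s /= [/andP[_]]].
have mI : a <= m <= t by rewrite am mt.
have fmc := is_derive_continuous (fdf m mI).
have bm : b <= f m.
  rewrite leNgt; apply/negP => fmb.
  have : \forall s \near m, f s < b
    by exact: (@cvgr_lt R R (nbhs m) _ f (f m) fmc b fmb).
  move=> -[/= e e0 he].
  have [s Es ms] := sup_adherent e0 supE.
  have sm : s <= m by exact: (ub_le_sup (proj2 supE)).
  have := he s; rewrite /ball_/= ger0_norm ?subr_ge0// ltrBlDr.
  by rewrite -ltrBlDl ms => /(_ isT); rewrite ltNge Es.2.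
have mltt : m < t.
  by rewrite lt_neqAle mt andbT; apply/eqP => mE; move: bm; rewrite mE leNgt ftb.
have : \forall y \near m^'+, b <= f y.
  move: bm; rewrite le_eqVlt => /orP[/eqP mE|bm].
    have := derive_gt0_right (fdf m mI) (df0 _ mI (esym mE)).
    by apply: filterS => y; rewrite mE => /ltW.
  apply: (@filterS _ _ _ (fun y => b < f y)); first by move=> y /ltW.
  by apply: cvg_within; exact: (@cvgr_gt R R (nbhs m) _ f (f m) fmc b bm).
move=> H.
have [y [[my yt] fy]] : exists y, (m < y /\ y <= t) /\ b <= f y.
  apply: (@filter_ex _ (m^'+)); near=> y; split; last by near: y.
  split; near: y; first exact: nbhs_right_gt.
  exact: nbhs_right_le.
have : y <= m.
  by apply: (ub_le_sup (proj2 supE)); split=> //; rewrite yt (le_trans am (ltW my)).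
by rewrite leNgt my.
Unshelve. all: by end_near. Qed.

(** A function that satisfies the logistic inequality f' >= k (1 - f^2) while
    |f| <= b reaches the level b within the time that ln ((1 + f) / (1 - f))
    needs to grow from its value at -b to its value at b. *)
Lemma logistic_reaches {R : realType} {f df : R -> R} {s0 L k b : R} :
  0 < b < 1 -> 0 < k -> ln ((1 + b) / (1 - b)) <= k * L ->
  (forall s, s0 <= s <= s0 + L -> is_derive s 1 f (df s)) ->
  (forall s, s0 <= s <= s0 + L -> `|f s| <= b -> k * (1 - f s ^+ 2) <= df s) ->
  `|f s0| <= b ->
  exists2 s, s0 <= s <= s0 + L & f s = b.
Proof.
move=> /andP[b0 b1] k0 kL fdf hdf; rewrite ler_norml => /andP[bf0 f0b].
have ln0 : 0 < ln ((1 + b) / (1 - b)).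
  by rewrite ln_gt0// ltr_pdivlMr ?mul1r ?subr_gt0//; lra.
have L0 : 0 < L by rewrite -(pmulr_rgt0 _ k0) (lt_le_trans ln0).
have sL : s0 <= s0 + L by rewrite lerDl ltW.
have subI s t : s0 <= s <= s0 + L -> s0 <= t <= s -> s0 <= t <= s0 + L.
  by move=> /andP[_ h] /andP[-> /le_trans ->].
have fc s : s0 <= s <= s0 + L -> {within `[s0, s]%classic, continuous f}.
  by move=> sI; apply: (@is_derive_within_continuous R f df) => t /(subI _ _ sI)/fdf.
apply: contrapT => nex.
have fltb s : s0 <= s <= s0 + L -> f s < b.
  move=> sI; rewrite ltNge; apply/negP => bfs; apply: nex.
  have /andP[s0s _] := sI.
  have [|c] := @IVT R f s0 s b s0s (fc _ sI).
    by rewrite ge_min f0b/= le_max bfs orbT.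
  by rewrite in_itv/= => cI fcb; exists c => //; exact: (subI s).
have bltf s : s0 <= s <= s0 + L -> - b <= f s.
  move=> sI; have /andP[s0s _] := sI.
  apply: (@ge_of_upward_crossing R f df s0 s) => //.
    by move=> t /(subI _ _ sI)/fdf.
  move=> t /(subI _ _ sI) tI ftb; apply: lt_le_trans (hdf t tI _); last first.
    by rewrite ftb normrN gtr0_norm.
  by rewrite mulr_gt0// ftb; nra.
(* the primitive of 2 f' / (1 - f^2) *)
pose g s := ln (1 + f s) - ln (1 - f s).
pose dg s := (1 + f s)^-1 * df s - (1 - f s)^-1 * - df s.
have gdg s : s0 <= s <= s0 + L -> is_derive s 1 g (dg s).
  move=> sI; have := fltb s sI; have := bltf s sI => fb bf.
  have fs := fdf s sI.
  apply: is_deriveB.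
    apply: (@is_derive1_comp R (@ln R) (fun s => 1 + f s)).
      by apply: is_derive1_ln; lra.
    rewrite -[X in is_derive _ _ _ X]add0r; exact: is_deriveD.
  apply: (@is_derive1_comp R (@ln R) (fun s => 1 - f s)).
    by apply: is_derive1_ln; lra.
  rewrite -[X in is_derive _ _ _ X]add0r; exact: is_deriveB.
have dgk s : s0 <= s <= s0 + L -> 2 * k <= dg s.
  move=> sI; have := fltb s sI; have := bltf s sI => fb bf.
  have -> : dg s = 2 * df s / (1 - f s ^+ 2).
    rewrite /dg; field; rewrite ?subr_eq0 ?addr_eq0.
    by apply/and3P; split; apply/eqP; nra.
  rewrite ler_pdivlMr; last nra.
  rewrite -mulrA ler_pM2l//; apply: hdf => //.
  by rewrite ler_norml; apply/andP; split; lra.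
have [||c cI gE] := @MVT_segment R g dg s0 (s0 + L) sL.
- by move=> s; rewrite in_itv/= => /andP[/ltW ? /ltW ?]; apply: gdg; apply/andP.
- exact: is_derive_within_continuous gdg.
have /dgk dgc : s0 <= c <= s0 + L by rewrite in_itv in cI.
have sLI : s0 <= s0 + L <= s0 + L by rewrite sL lexx.
have s0I : s0 <= s0 <= s0 + L by rewrite sL lexx.
have g1 : g (s0 + L) < ln (1 + b) - ln (1 - b).
  have := fltb _ sLI; have := bltf _ sLI => fb bf; rewrite /g.
  by rewrite ltrB// ltr_ln ?posrE; lra.
have g0 : - (ln (1 + b) - ln (1 - b)) <= g s0.
  rewrite /g opprB lerB// ler_ln ?posrE; lra.
move: kL; rewrite ln_div ?posrE; [|lra|lra] => kL.
have : 2 * k * L <= dg c * (s0 + L - s0).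
  by rewrite addrAC subrr add0r ler_pM2r.
rewrite -gE; lra.
Qed.

(** The same, backwards in time. *)
Lemma logistic_reaches_left {R : realType} {f df : R -> R} {s0 L k b : R} :
  0 < b < 1 -> 0 < k -> ln ((1 + b) / (1 - b)) <= k * L ->
  (forall s, s0 - L <= s <= s0 -> is_derive s 1 f (df s)) ->
  (forall s, s0 - L <= s <= s0 -> `|f s| <= b -> k * (1 - f s ^+ 2) <= df s) ->
  `|f s0| <= b ->
  exists2 s, s0 - L <= s <= s0 & f s = - b.
Proof.
move=> b01 k0 kL fdf hdf f0.
have flip s : - s0 <= s <= - s0 + L -> s0 - L <= - s <= s0 by lra.
have [|||s sI fs] := @logistic_reaches R (fun s => - f (- s)) (fun s => df (- s))
    (- s0) L k b b01 k0 kL.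
- move=> s /flip /fdf fs.
  have fN := is_derive1_comp fs (is_deriveNid s 1).
  by have := is_deriveN fN; rewrite mulrN1 opprK.
- by move=> s /flip sI; rewrite normrN sqrrN; exact: hdf.
- by rewrite opprK normrN.
- by exists (- s); [exact: flip|rewrite -fs opprK].
Qed.

Lemma dist_le_derive_bound {R : realType} {f df : R -> R} {B : R} (x y : R) :
  (forall s : R, is_derive s 1 f (df s)) -> (forall s, `|df s| <= B) ->
  `|f y - f x| <= B * `|y - x|.
Proof.
move=> fdf dfB; wlog xy : x y / x <= y.
  by move=> H; case/orP: (le_total x y) => /H // ; rewrite distrC (distrC x).
have [|c _ ->] := @MVT_segment R f df x y xy.
- by apply: (@is_derive_within_continuous R f df) => s _; exact: fdf.
- by rewrite normrM ler_wpM2r.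
Qed.

(** * The Euclidean inner product *)

Section Euclidean.
Context {R : realType} {n : nat}.
Implicit Types (x y z : 'cV[R]_n) (A : 'M[R]_n).

Lemma dotvC x y : dotv x y = dotv y x.
Proof. by apply: eq_bigr => i _; rewrite mulrC. Qed.

Lemma dotvDl x y z : dotv (x + y) z = dotv x z + dotv y z.
Proof. by rewrite -big_split; apply: eq_bigr => i _; rewrite mxE mulrDl. Qed.

Lemma dotvZl (k : R) x y : dotv (k *: x) y = k * dotv x y.
Proof. by rewrite mulr_sumr; apply: eq_bigr => i _; rewrite mxE mulrA. Qed.

Lemma dotvNl x y : dotv (- x) y = - dotv x y.
Proof. by rewrite -scaleN1r dotvZl mulN1r. Qed.

Lemma dotvDr x y z : dotv x (y + z) = dotv x y + dotv x z.
Proof. by rewrite dotvC dotvDl !(dotvC x). Qed.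

Lemma dotvZr (k : R) x y : dotv x (k *: y) = k * dotv x y.
Proof. by rewrite dotvC dotvZl dotvC. Qed.

Lemma dotv_ge0 x : 0 <= dotv x x.
Proof. by apply: sumr_ge0 => i _; rewrite -expr2 sqr_ge0. Qed.

Lemma enorm_ge0 x : 0 <= enorm x.
Proof. exact: sqrtr_ge0. Qed.

Lemma sqr_enorm x : enorm x ^+ 2 = dotv x x.
Proof. by rewrite sqr_sqrtr// dotv_ge0. Qed.

Lemma coord_le_enorm x i : `|x i 0| <= enorm x.
Proof.
rewrite -(@ler_pXn2r _ 2)// ?nnegrE ?enorm_ge0// sqr_enorm real_normK ?num_real//.
rewrite /dotv (bigD1 i)//= -expr2 lerDl; apply: sumr_ge0 => j _.
by rewrite -expr2 sqr_ge0.
Qed.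

Lemma cauchy_schwarz x y : `|dotv x y| <= enorm x * enorm y.
Proof.
rewrite -(@ler_pXn2r _ 2)// ?nnegrE ?mulr_ge0 ?enorm_ge0//.
rewrite exprMn !sqr_enorm real_normK ?num_real//.
have := dotv_ge0 (dotv y y *: x - dotv x y *: y).
rewrite !(dotvDl, dotvDr, dotvNl, dotvZl, dotvZr, =^~ scaleNr) (dotvC y x).
have : 0 <= dotv y y by exact: dotv_ge0.
rewrite le_eqVlt => /orP[/eqP y0 _|]; last nra.
suff -> : dotv x y = 0 by rewrite -y0 mulr0 expr0n.
apply: big1 => i _; have := coord_le_enorm y i.
by rewrite /enorm -y0 sqrtr0 normr_le0 => /eqP ->; rewrite mulr0.
Qed.

(** The sum of the absolute values of the entries: a crude bound for the
    operator norm. *)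
Definition entrysum A : R := \sum_i \sum_j `|A i j|.

Lemma entrysum_ge0 A : 0 <= entrysum A.
Proof. by apply: sumr_ge0 => i _; apply: sumr_ge0. Qed.

Lemma dotv_mulmx_le A x y :
  `|dotv x (A *m y)| <= entrysum A * (enorm x * enorm y).
Proof.
rewrite /dotv /entrysum mulr_suml (le_trans (ler_norm_sum _ _ _))//.
apply: ler_sum => i _; rewrite mxE mulr_sumr mulr_suml.
rewrite (le_trans (ler_norm_sum _ _ _))//; apply: ler_sum => j _.
rewrite mulrCA normrM normrM ler_wpM2l//.
by rewrite ler_pM// coord_le_enorm.
Qed.

Lemma dotv_trmx A x y : dotv x (A *m y) = dotv (A^T *m x) y.
Proof.
rewrite /dotv; under eq_bigr do rewrite mxE mulr_sumr.
rewrite exchange_big/=; apply: eq_bigr => j _; rewrite mxE mulr_suml.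
by apply: eq_bigr => i _; rewrite mxE; ring.
Qed.

Lemma dotv_antisym A x : A^T = - A -> dotv x (A *m x) = 0.
Proof.
move=> hA; have := dotv_trmx A x x; rewrite hA mulNmx dotvNl dotvC; lra.
Qed.

End Euclidean.

(** * Derivatives of vector-valued functions *)

Section VectorDerivatives.
Context {R : realType} {n : nat}.
Implicit Types (f g : R -> 'cV[R]_n) (F G : 'cV[R]_n).

Lemma is_derive_coordP f F (s : R) :
  is_derive s 1 f F <-> forall i, is_derive s 1 (fun t => f t i 0) (F i 0).
Proof.
split=> [[fs <-] i|fF].
  split; first by have /derivable_mxP := fs; exact.
  by rewrite derive_mx// mxE.
have fs : derivable f s 1.
  by apply/derivable_mxP => i j; rewrite (ord1 j); case: (fF i).
split=> //; apply/matrixP => i j; rewrite derive_mx// mxE (ord1 j).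
by case: (fF i).
Qed.

Lemma is_derive_bigsum m (h : 'I_m -> R -> R) (dh : 'I_m -> R) (s : R) :
  (forall i, is_derive s 1 (h i) (dh i)) ->
  is_derive s 1 (fun t => \sum_(i < m) h i t) (\sum_(i < m) dh i).
Proof.
move=> /is_derive_sum; congr (is_derive _ _ _ _); apply/funext => t.
by rewrite fct_sumE.
Qed.

Lemma is_derive_dotv f g F G (s : R) :
  is_derive s 1 f F -> is_derive s 1 g G ->
  is_derive s 1 (fun t => dotv (f t) (g t)) (dotv F (g s) + dotv (f s) G).
Proof.
move=> /is_derive_coordP fF /is_derive_coordP gG; rewrite /dotv -big_split/=.
apply: is_derive_bigsum => i; rewrite addrC (mulrC (F i 0)).
exact: (is_deriveM (fF i) (gG i)).
Qed.

Lemma is_derive_mulmx (M : 'M[R]_n) f F (s : R) :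
  is_derive s 1 f F -> is_derive s 1 (fun t => M *m f t) (M *m F).
Proof.
move=> /is_derive_coordP fF; apply/is_derive_coordP => i; rewrite mxE.
under eq_fun do rewrite mxE.
by apply: is_derive_bigsum => j; exact: (is_deriveZ (M i j) (fF j)).
Qed.

End VectorDerivatives.

(** * The evolution of mu along a soliton *)

(** The derivative of mu along a soliton, written in terms of the length [p]
    of the vector a, of q = <a, T> and of beta = <a, A T>. *)
Definition mu_slope {R : realType} (alpha p q beta : R) : R :=
  (alpha + p ^+ 2 - q ^+ 2) / p - q * (alpha * q + beta) / p ^+ 3.

(** For large [A0] the two error terms, in alpha and in beta, are each at most
    a quarter of A0 / 2 * (1 - m^2); for the second one this requires a lower
    bound on r = sqrt (1 - m^2), as beta is only of first order in [r]. *)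
Lemma mu_slope_ge {R : realType} {alpha K A0 p m beta r : R} :
  0 < A0 -> A0 / 2 <= p -> 16 * `|alpha| <= A0 ^+ 2 ->
  0 <= r -> r ^+ 2 = 1 - m ^+ 2 -> 16 * K <= A0 ^+ 2 * r ->
  `|beta| <= K * (p * r) ->
  A0 / 4 * (1 - m ^+ 2) <= mu_slope alpha p (p * m) beta.
Proof.
move=> A00 pA hal r0 rm hK hbeta.
have p0 : 0 < p by lra.
have -> : mu_slope alpha p (p * m) beta =
    (p + alpha / p) * (1 - m ^+ 2) - m * (beta / p) / p.
  by rewrite /mu_slope; field; rewrite gt_eqF.
rewrite -rm.
have alp : `|alpha / p| <= A0 / 8.
  rewrite normrM normfV (gtr0_norm p0) ler_pdivrMr//; nra.
have m1 : `|m| <= 1.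
  by rewrite -(@ler_pXn2r _ 2)// ?nnegrE// real_normK ?num_real// expr1n; nra.
have bp : `|beta / p| <= K * r.
  by rewrite normrM normfV (gtr0_norm p0) ler_pdivrMr//; lra.
have h : `|m * (beta / p) / p| <= A0 / 8 * r ^+ 2.
  rewrite normrM normfV (gtr0_norm p0) ler_pdivrMr// normrM.
  apply: (@le_trans _ _ (K * r)).
    by rewrite -[leRHS]mul1r ler_pM.
  apply: (@le_trans _ _ (A0 / 8 * r ^+ 2 * (A0 / 2))); last first.
    by apply: ler_wpM2l => //; rewrite mulr_ge0 ?sqr_ge0// divr_ge0// ltW.
  have := ler_wpM2r r0 hK; lra.
have := ler_norm (m * (beta / p) / p).
have := ler_norm (- (alpha / p)); rewrite normrN.
have := sqr_ge0 r.
nra.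
Qed.

Section SolitonMu.
Context {R : realType} {n : nat} {alpha : R} {A : 'M[R]_n} {v : 'cV[R]_n}.
Context (hA : A^T = - A) {c : R -> 'cV[R]_n} (hc : soliton alpha A v c).

Let a (s : R) := avec alpha A v (c s).
Let T (s : R) := derive1 c s.

Lemma dotv_tangent (s : R) : dotv (T s) (T s) = 1.
Proof. by case: hc => _ h _; rewrite -sqr_enorm h expr1n. Qed.

Lemma soliton_is_derive_avec (s : R) :
  is_derive s 1 a ((alpha%:M + A) *m T s).
Proof.
have [/(_ 0%N s)/= cs _ _] := hc.
have cT : is_derive s 1 c (T s) by split=> //; rewrite /T derive1E.
by have := is_deriveD (is_derive_mulmx (alpha%:M + A) _ _ _ cT)
  (is_derive_cst v s (1 : R)); rewrite addr0.
Qed.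

Lemma soliton_is_derive_tangent (s : R) :
  is_derive s 1 T (a s - dotv (a s) (T s) *: T s).
Proof.
have [/(_ 1%N s)/= cs _ /(_ s)/= h] := hc.
by split=> //; rewrite -derive1E h scaleNr.
Qed.

Lemma dotv_scalar_addmx (x y : 'cV[R]_n) :
  dotv x ((alpha%:M + A) *m y) = alpha * dotv x y + dotv x (A *m y).
Proof. by rewrite mulmxDl mul_scalar_mx dotvDr dotvZr. Qed.

Lemma soliton_is_derive_mu (s : R) : 0 < enorm (a s) ->
  is_derive s 1 (fun t => mu alpha A v (c t) (derive1 c t))
    (mu_slope alpha (enorm (a s)) (dotv (a s) (T s)) (dotv (a s) (A *m T s))).
Proof.
move=> p0.
have da := soliton_is_derive_avec s.
have dT := soliton_is_derive_tangent s.
have dq := is_derive_dotv _ _ _ _ _ da dT.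
have dP := is_derive_dotv _ _ _ _ _ da da.
have P0 : 0 < dotv (a s) (a s) by rewrite -sqr_enorm exprn_gt0.
have dp := is_derive1_comp (is_derive1_sqrt P0) dP.
have pN0 : (Num.sqrt \o (fun t => dotv (a t) (a t))) s != 0 by rewrite gt_eqF.
have dV := is_deriveV pN0 dp.
have := is_deriveM dV dq.
set F := (X in is_derive _ _ X _ -> _).
have -> : F = (fun t => mu alpha A v (c t) (derive1 c t)).
  by apply/funext => t; rewrite /mu /ahat dotvZl.
move=> dF; apply: is_derive_eq => {dF}.
rewrite /GRing.scale/= -/(enorm (a s)).
rewrite !(dotvC (_ *m _)).
rewrite !dotv_scalar_addmx dotv_antisym// dotv_tangent.
rewrite dotvDr -scaleNr dotvZr -sqr_enorm.
set p := enorm _; set q := dotv (a s) (T s); set beta := dotv _ _.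
by rewrite /mu_slope; field; rewrite gt_eqF.
Qed.

(** Only the part of the unit vector [t] orthogonal to [x] contributes to
    <x, A t>, and its length is the square root of 1 - m^2, where m is the
    cosine of the angle between [x] and [t]. *)
Lemma dotv_antisym_tangent_le (x t : 'cV[R]_n) :
  0 < enorm x -> dotv t t = 1 ->
  `|dotv x (A *m t)| <=
  entrysum A * (enorm x * Num.sqrt (1 - (dotv x t / enorm x) ^+ 2)).
Proof.
move=> p0 tt; set k := dotv x t / enorm x ^+ 2.
have -> : dotv x (A *m t) = dotv x (A *m (t - k *: x)).
  by rewrite mulmxBr -scalemxAr dotvDr -scaleNr dotvZr dotv_antisym// mulr0 addr0.
suff -> : 1 - (dotv x t / enorm x) ^+ 2 = dotv (t - k *: x) (t - k *: x).
  exact: dotv_mulmx_le.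
rewrite -(scaleNr k x) !(dotvDr, dotvDl, dotvZl, dotvZr) tt (dotvC t x) -sqr_enorm.
by rewrite /k; field; rewrite gt_eqF.
Qed.

(** The length of the vector a decreases at bounded speed; pairing with the
    fixed vector a(s0) avoids differentiating the length where it may vanish. *)
Lemma soliton_enorm_avec_ge (s0 s : R) :
  enorm (a s0) - (`|alpha| + entrysum A) * `|s - s0| <= enorm (a s).
Proof.
set w := a s0; set M : R := `|alpha| + entrysum A.
have [w0|w0] := eqVneq (enorm w) 0.
  apply: (@le_trans _ _ 0); last exact: enorm_ge0.
  by rewrite w0 sub0r oppr_le0 mulr_ge0// addr_ge0// entrysum_ge0.
have {}w0 : 0 < enorm w by rewrite lt_neqAle eq_sym w0 enorm_ge0.
have dq (t : R) : is_derive t 1 (fun t => dotv (a t) w)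
    (dotv ((alpha%:M + A) *m T t) w).
  have := is_derive_dotv _ _ _ _ _ (soliton_is_derive_avec t)
    (is_derive_cst w t (1 : R)).
  by rewrite (dotvC (a t) 0) -(scale0r 0) dotvZl mul0r addr0.
have dB t : `|dotv ((alpha%:M + A) *m T t) w| <= M * enorm w.
  have T1 : enorm (T t) = 1 by case: hc.
  rewrite dotvC dotv_scalar_addmx (le_trans (ler_normD _ _))// mulrDl normrM.
  apply: lerD.
    by rewrite ler_wpM2l// (le_trans (cauchy_schwarz _ _))// T1 mulr1.
  by have := dotv_mulmx_le A w (T t); rewrite T1 mulr1.
have := dist_le_derive_bound s0 s dq dB.
rewrite -/w -sqr_enorm distrC => /ler_normlW.
have := le_trans (ler_norm _) (cauchy_schwarz (a s) w).
move=> h1 h2; rewrite -(ler_pM2r w0); nra.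
Qed.

Lemma soliton_mu_slope_ge (A0 eps s : R) :
  0 < A0 -> A0 / 2 <= enorm (a s) -> 16 * `|alpha| <= A0 ^+ 2 ->
  0 <= eps -> (16 * entrysum A) ^+ 2 <= A0 ^+ 4 * eps ->
  let m := mu alpha A v (c s) (derive1 c s) in
  `|m| <= 1 - eps ->
  A0 / 4 * (1 - m ^+ 2) <=
  mu_slope alpha (enorm (a s)) (dotv (a s) (T s)) (dotv (a s) (A *m T s)).
Proof.
move=> A00 pA hal eps0 hK m hm.
have p0 : 0 < enorm (a s) by lra.
have mE : m = dotv (a s) (T s) / enorm (a s).
  by rewrite /m /mu /ahat dotvZl mulrC.
have -> : dotv (a s) (T s) = enorm (a s) * m by rewrite mE; field; rewrite gt_eqF.
have m2 : eps <= 1 - m ^+ 2.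
  have := normr_ge0 m; rewrite -(real_normK (num_real m)); nra.
have m20 : 0 <= 1 - m ^+ 2 by exact: le_trans m2.
apply: (@mu_slope_ge R alpha (entrysum A) A0 _ _ _ (Num.sqrt (1 - m ^+ 2))) => //.
- by rewrite sqr_sqrtr.
- rewrite -(@ler_pXn2r _ 2)// ?nnegrE ?mulr_ge0 ?entrysum_ge0 ?sqr_ge0//.
  rewrite [leRHS]exprMn sqr_sqrtr// -exprM (le_trans hK)// ler_wpM2l//.
  by rewrite exprn_ge0 ?ltW.
  1,2: exact: ltW.
- by rewrite mE; apply: dotv_antisym_tangent_le => //; exact: dotv_tangent.
Qed.

End SolitonMu.

Theorem lemma7p2 (R : realType) (n : nat) (alpha : R) (A : 'M[R]_n)
    (hA : A^T = - A) :
  exists C : R, 0 < C /\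
    forall v : 'cV[R]_n, A *m v = 0 -> (alpha != 0 -> v = 0) ->
    forall (c : R -> 'cV[R]_n) (s0 : R), soliton alpha A v c ->
    let mus := fun s : R => mu alpha A v (c s) (derive1 c s) in
    let A0 := enorm (avec alpha A v (c s0)) in
    C <= A0 -> `|mus s0| <= 1 - C * A0 ^- 4 ->
    exists sm sp : R,
      [/\ sm < sp,
          sm <= s0 <= sp,
          sp - sm <= C / A0 * ln A0,
          mus sm = - (1 - C * A0 ^- 4) &
          mus sp = 1 - C * A0 ^- 4].
Proof.
set K := entrysum A; set M := `|alpha| + K.
have K0 : 0 <= K := entrysum_ge0 A.
have M0 : 0 <= M by rewrite addr_ge0.
(* [32] bounds the length of the arc, [32 * M] keeps the length of a above
   A0 / 2, [256 * K ^+ 2] and [16 * `|alpha|] absorb the error terms in mu'. *)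
set C : R := 32 + 32 * M + 256 * K ^+ 2 + 16 * `|alpha|.
have K20 := sqr_ge0 K; have al0 := normr_ge0 alpha.
have C32 : 32 <= C by rewrite /C; lra.
exists C; split; first lra.
move=> v _ _ c s0 hc mus A0 CA0 hmu0.
have A032 : 32 <= A0 by lra.
have A00 : 0 < A0 by lra.
have A040 : 0 < A0 ^+ 4 by exact: exprn_gt0.
set eps := C * A0 ^- 4.
have epsA : A0 ^+ 4 * eps = C by rewrite /eps; field; rewrite gt_eqF.
have eps0 : 0 < eps by rewrite divr_gt0//; lra.
have A04 : A0 < A0 ^+ 4 by rewrite -[ltLHS]expr1 ltr_eXn2l//; lra.
have eps1 : eps < 1 by rewrite ltr_pdivrMr//; lra.
set b := 1 - eps.
have b01 : 0 < b < 1 by rewrite /b; lra.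
have lnA0 : 0 <= ln A0 by apply: ln_ge0; lra.
have lnA : ln A0 <= A0.
  have : ln (1 + (A0 - 1)) <= A0 - 1 by apply: le_ln1Dx; lra.
  by rewrite addrC subrK; lra.
set L := 16 * ln A0 / A0.
have L0 : 0 <= L by rewrite divr_ge0// ?mulr_ge0// ltW.
have LA : L * A0 = 16 * ln A0 by rewrite /L divfK// gt_eqF.
have hL : ln ((1 + b) / (1 - b)) <= A0 / 4 * L.
  have -> : A0 / 4 * L = ln (A0 ^+ 4) by rewrite lnXn// -mulr_natr; lra.
  have b1 : 0 < 1 - b by rewrite /b; lra.
  rewrite ler_ln ?posrE ?divr_gt0//; last by rewrite /b; lra.
  by rewrite ler_pdivrMr// /b; lra.
(* M L <= A0 / 2, by ln A0 <= A0 and 32 M <= C <= A0 *)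
have hp s : s0 - L <= s <= s0 + L -> A0 / 2 <= enorm (avec alpha A v (c s)).
  move=> sI; apply: le_trans (soliton_enorm_avec_ge hc s0 s).
  rewrite -/A0 -/K -/M.
  have : `|s - s0| <= L by rewrite ler_distl; lra.
  move=> /(ler_wpM2l M0).
  have : M * L <= A0 / 2.
    rewrite -(ler_pM2r A00) -mulrA LA.
    have : M * ln A0 <= M * A0 by rewrite ler_wpM2l.
    have : 32 * M * A0 <= A0 * A0 by rewrite ler_pM2r// /C in CA0 *; lra.
    lra.
  lra.
set df := fun s => mu_slope alpha (enorm (avec alpha A v (c s)))
  (dotv (avec alpha A v (c s)) (derive1 c s))
  (dotv (avec alpha A v (c s)) (A *m derive1 c s)).
have dmu s : s0 - L <= s <= s0 + L -> is_derive s 1 mus (df s).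
  by move=> /hp ps; apply: soliton_is_derive_mu => //; lra.
have dmu_ge s : s0 - L <= s <= s0 + L -> `|mus s| <= b ->
    A0 / 4 * (1 - mus s ^+ 2) <= df s.
  move=> /hp ps ms.
  apply: (soliton_mu_slope_ge hA hc A0 eps) => //; last 2 first.
  - exact: ltW.
  - by rewrite epsA /C exprMn -/K; lra.
  have : A0 * 1 <= A0 * A0 by rewrite ler_pM2l//; lra.
  by rewrite /C in CA0; rewrite expr2; lra.
have k0 : 0 < A0 / 4 by lra.
have [||sp spI spE] := @logistic_reaches R mus df s0 L (A0 / 4) b b01 k0 hL _ _ hmu0.
- by move=> s sI; apply: dmu; lra.
- by move=> s sI; apply: dmu_ge; lra.
have [||sm smI smE] :=
  @logistic_reaches_left R mus df s0 L (A0 / 4) b b01 k0 hL _ _ hmu0.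
- by move=> s sI; apply: dmu; lra.
- by move=> s sI; apply: dmu_ge; lra.
exists sm, sp; split=> //.
- rewrite lt_neqAle; apply/andP; split; last lra.
  by apply/eqP => E; move: smE; rewrite E spE; lra.
- lra.
- apply: (@le_trans _ _ (2 * L)); first lra.
  have -> : 2 * L = 32 / A0 * ln A0 by rewrite /L; lra.
  by rewrite ler_wpM2r// ler_pM2r// invr_gt0.
Qed.
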